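(* Let $f:\mathbb{R}^d\to\mathbb{R}$ be convex and twice differentiable, and let $H>0$ be such that for all $x,y\in\mathbb{R}^d$ $$f(y)\le f(x)+\langle\nabla f(x),y-x\rangle+\tfrac12\langle\nabla^2 f(x)(y-x),y-x\rangle+\tfrac H3\|y-x\|^3,\qquad \|\nabla f(y)-\nabla f(x)-\nabla^2 f(x)(y-x)\|\le H\|y-x\|^2 .$$ Let $x^0\in\mathbb{R}^d$, let $x^\star$ be a minimizer of $f$, $f_\star=f(x^\star)$, and assume $D:=\sup\{\|x-x^\star\|:\ f(x)\le f(x^0)\}<\infty$. Let $C>0$, $M=\max\{H,C\}$, and let $(x^k)_{k\ge0}$ be defined by $x^{k+1}=x^k-\frac{\nabla f(x^k)}{\sqrt{M\|\nabla f(x^k)\|}}$ (with $x^{k+1}=x^k$ if $\nabla f(x^k)=0$). Assume that for every $k$ with $\nabla f(x^k)\neq0$ $$\frac{\langle\nabla f(x^k),\nabla^2 f(x^k)\nabla f(x^k)\rangle}{\|\nabla f(x^k)\|^2}\le\sqrt{C\|\nabla f(x^k)\|}.$$ Then for all $k\ge0$ $$f(x^{k+1})\le f(x^k)-\frac{1}{6\sqrt M}\|\nabla f(x^k)\|^{3/2},$$ and there is an absolute constant $c>0$ (independent of $f,d,H,C,x^0,k$) such that for all $k\ge1$ $$f(x^k)-f_\star\le c\,\frac{\big(\sqrt{MD^3}+\sqrt{f(x^0)-f_\star}\big)^2}{k^2}.$$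
   Context: $\|\cdot\|$ is the Euclidean norm on $\mathbb{R}^d$. *)

(* Defs.v *)
From mathcomp Require Import all_boot all_order all_algebra.
From mathcomp Require Import all_classical all_reals all_analysis.
Import Order.TTheory GRing.Theory Num.Theory.
Import numFieldNormedType.Exports.

Set Implicit Arguments.
Unset Strict Implicit.
Unset Printing Implicit Defensive.

Local Open Scope classical_set_scope.
Local Open Scope ring_scope.

Definition dotv (R : realType) (d : nat) (u v : 'rV[R]_d) : R :=
  \sum_(i < d) u 0 i * v 0 i.

(* The library norm `|u| on 'rV[R]_d is the sup norm, hence this definition.
   Both norms induce the same topology, so [differentiable] and ['d] do not
   depend on which one is used. *)
Definition enorm (R : realType) (d : nat) (u : 'rV[R]_d) : R :=
  Num.sqrt (dotv u u).

Definition grad (R : realType) (d : nat) (f : 'rV[R]_d -> R) (x : 'rV[R]_d)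
    : 'rV[R]_d :=
  \row_(i < d) 'd f x (delta_mx 0 i).

Definition twice_differentiable (R : realType) (d : nat) (f : 'rV[R]_d -> R)
    : Prop :=
  (forall x, differentiable f x) /\ (forall x, differentiable (grad f) x).

(* Vectors are rows and a Jacobian acts by multiplication on the right:
   v *m hessian f x is the derivative of [grad f] at x in the direction v. *)
Definition hessian (R : realType) (d : nat) (f : 'rV[R]_d -> R) (x : 'rV[R]_d)
    : 'M[R]_d :=
  'J (grad f) x.

(* Main.v *)
Require Import Defs.
From mathcomp Require Import all_boot all_order all_algebra.
From mathcomp Require Import all_classical all_reals all_analysis.
From mathcomp Require Import ring lra.
Import Order.TTheory GRing.Theory Num.Theory.
Import numFieldNormedType.Exports.

Local Open Scope classical_set_scope.
Local Open Scope ring_scope.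

(** The step x - g / sqrt(M |g|), where g is the gradient at x, has length
    sqrt(|g| / M).  In the cubic upper model of f at x its linear part
    contributes - |g|^(3/2) / sqrt M; the curvature condition along g and
    C <= M bound the quadratic part by half of |g|^(3/2) / sqrt M, and H <= M
    bounds the cubic part by a third of it.  What remains is the decrease by a
    sixth ([regularized_step_decrease]).

    In particular the iterates stay in the initial sublevel set, so they are
    at distance at most D from xstar, and convexity with Cauchy-Schwarz gives
    f (x k) - f xstar <= |g_k| D ([convex_gradient_le], [dotv_le_enorm]).
    Hence a small decrease forces a small gap: with delta_k the gap at step k,
    delta_k^(3/2) <= 6 sqrt(M D^3) (delta_k - delta_(k+1)).  This is a discrete
    form of the differential inequality delta' <= - a delta^(3/2), along which
    delta^(-1/2) grows at least linearly ([sqrt_gap_rate]).  It yields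
    delta_k <= 144 M D^3 / k^2, which the stated bound dominates with
    c = 144. *)

(** * The Euclidean structure on row vectors *)

Section Euclidean.
Context {R : realType} {d : nat}.
Implicit Types (u v : 'rV[R]_d) (a : R).

Lemma dotvC u v : dotv u v = dotv v u.
Proof. by apply: eq_bigr => i _; rewrite mulrC. Qed.

Lemma dotvZl a u v : dotv (a *: u) v = a * dotv u v.
Proof. by rewrite /dotv mulr_sumr; apply: eq_bigr => i _; rewrite mxE mulrA. Qed.

Lemma dotvZr a u v : dotv u (a *: v) = a * dotv u v.
Proof. by rewrite dotvC dotvZl dotvC. Qed.

Lemma dotvv_ge0 u : 0 <= dotv u u.
Proof. by apply: sumr_ge0 => i _; rewrite -expr2 sqr_ge0. Qed.

Lemma enorm_ge0 u : 0 <= enorm u.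
Proof. exact: sqrtr_ge0. Qed.

Lemma enorm_sqr u : enorm u ^+ 2 = dotv u u.
Proof. by rewrite sqr_sqrtr ?dotvv_ge0. Qed.

Lemma enormZ a u : enorm (a *: u) = `|a| * enorm u.
Proof.
by rewrite /enorm dotvZl dotvZr mulrA -expr2 sqrtrM ?sqr_ge0 // sqrtr_sqr.
Qed.

Lemma enorm_eq0 u : (enorm u == 0) = (u == 0).
Proof.
apply/idP/eqP => [|->]; last first.
  by rewrite -(scale0r (0 : 'rV_d)) enormZ normr0 mul0r.
rewrite -sqrf_eq0 enorm_sqr psumr_eq0; last by move=> i _; rewrite -expr2 sqr_ge0.
move=> /allP u0; apply/rowP => i; apply/eqP.
by have := u0 i (mem_index_enum _); rewrite -expr2 sqrf_eq0 mxE.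
Qed.

(** Cauchy-Schwarz: expanding the square norm of |v| u - |u| v gives
    2 |u| |v| (|u| |v| - <u, v>) >= 0. *)
Lemma dotv_le_enorm u v : dotv u v <= enorm u * enorm v.
Proof.
have [->|u0] := eqVneq u 0.
  by rewrite -(scale0r (0 : 'rV_d)) dotvZl enormZ normr0 !mul0r.
have [->|v0] := eqVneq v 0.
  by rewrite -(scale0r (0 : 'rV_d)) dotvZr enormZ normr0 !mul0r mulr0.
have uv_gt0 : 0 < enorm u * enorm v.
  by rewrite mulr_gt0 // lt0r enorm_eq0 enorm_ge0 ?u0 ?v0.
have expand : 0 <= enorm v ^+ 2 * dotv u u + enorm u ^+ 2 * dotv v v
                   - 2 * (enorm u * enorm v) * dotv u v.
  rewrite /dotv !mulr_sumr -big_split -sumrB /=.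
  apply: sumr_ge0 => i _.
  have := sqr_ge0 (enorm v * u 0 i - enorm u * v 0 i).
  by congr (0 <= _); ring.
rewrite -(ler_pM2l uv_gt0).
by move: expand; rewrite -!enorm_sqr; lra.
Qed.

End Euclidean.

(** * Gradients of convex functions *)

Lemma diff_grad (R : realType) (d : nat) (f : 'rV[R]_d -> R) (x v : 'rV[R]_d) :
  differentiable f x -> 'd f x v = dotv (grad f x) v.
Proof.
move=> df; rewrite {1}(row_sum_delta v) linear_sum.
by apply: eq_bigr => i _; rewrite linearZ mxE mulrC.
Qed.

(** The graph of f lies above its tangent hyperplanes: by convexity the
    difference quotients of f at x in the direction y - x are at most
    f y - f x for steps in ]0, 1], and they tend to <grad f x, y - x>. *)
Lemma convex_gradient_le (R : realType) (d : nat) (f : 'rV[R]_d -> R)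
    (x y : 'rV[R]_d) :
  convex_function setT f -> differentiable f x ->
  dotv (grad f x) (y - x) <= f y - f x.
Proof.
move=> cf df; rewrite -diff_grad // -deriveE //.
have /cvg_dnbhs_at_right slope : (h^-1 *: ((f \o shift x) (h *: (y - x)) - f x)
    @[h --> 0^'] --> 'D_(y - x) f x) by exact: diff_derivable.
apply: (cvgr_to_le slope).
near=> h.
have h0 : 0 < h by near: h; exact: nbhs_right_gt.
have h1 : h <= 1 by near: h; exact: nbhs_right_le.
have := cf (Itv01 (ltW h0) h1) y x; rewrite !inE => /(_ Logic.I Logic.I).
rewrite convRE /= /conv /= /unstable.onem => fh.
have -> : h *: (y - x) + x = h *: y + (1 - h) *: x.
  by rewrite scalerBr scalerBl scale1r -addrA; congr (_ + _); rewrite addrC.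
rewrite [leLHS]mulrC ler_pdivrMr //.
apply: le_trans (lerB fh (lexx _)) _.
by rewrite le_eqVlt; apply/orP; left; apply/eqP; ring.
Unshelve. all: by end_near.
Qed.

(** * The decrease of one step *)

Lemma powR_3half (R : realType) (a : R) :
  0 <= a -> a `^ (3 / 2) = Num.sqrt a ^+ 3.
Proof.
by move=> a0; rewrite mulrC powRrM powR12_sqrt // powR_mulrn ?sqrtr_ge0.
Qed.

Lemma regularized_step_decrease (R : realType) (d : nat) (f : 'rV[R]_d -> R)
    (H C M : R) (x : 'rV[R]_d) :
  0 < H -> 0 < C -> H <= M -> C <= M ->
  (forall y : 'rV[R]_d,
     f y <= f x + dotv (grad f x) (y - x)
            + 1 / 2 * dotv ((y - x) *m hessian f x) (y - x)
            + H / 3 * enorm (y - x) ^+ 3) ->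
  grad f x != 0 ->
  dotv (grad f x) (grad f x *m hessian f x) / enorm (grad f x) ^+ 2
    <= Num.sqrt (C * enorm (grad f x)) ->
  f (x - (Num.sqrt (M * enorm (grad f x)))^-1 *: grad f x)
    <= f x - 1 / (6 * Num.sqrt M) * enorm (grad f x) `^ (3 / 2).
Proof.
move=> H0 C0 HM CM upper gn0 curv.
have M0 : 0 < M by exact: lt_le_trans HM.
have g0 : 0 < enorm (grad f x) by rewrite lt0r enorm_eq0 gn0 enorm_ge0.
have := upper (x - (Num.sqrt (M * enorm (grad f x)))^-1 *: grad f x).
rewrite [x - _ - x]addrAC subrr add0r powR_3half ?enorm_ge0 // -scaleNr -scalemxAl.
rewrite !dotvZl !dotvZr enormZ normrN -enorm_sqr.
move: curv; rewrite ler_pdivrMr ?exprn_gt0 //.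
rewrite [X in X <= _]dotvC.
set q := dotv (grad f x *m _) _; set g := enorm (grad f x) in g0 *.
rewrite !sqrtrM ?(ltW M0) ?(ltW C0) // normfV.
set p := Num.sqrt g; set m := Num.sqrt M; set c := Num.sqrt C.
have p0 : 0 < p by rewrite sqrtr_gt0.
have m0 : 0 < m by rewrite sqrtr_gt0.
have gE : g = p ^+ 2 by rewrite sqr_sqrtr // ltW.
have cm : c <= m by rewrite ler_wsqrtr.
have Hm : H <= m ^+ 2 by rewrite sqr_sqrtr // ltW.
rewrite ger0_norm ?mulr_ge0 ?(ltW p0) ?(ltW m0) // gE => curv decr.
have quad : q <= p ^+ 5 * m.
  apply: le_trans curv _.
  have -> : c * p * (p ^+ 2) ^+ 2 = p ^+ 5 * c by ring.
  by rewrite ler_pM2l // exprn_gt0.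
apply: le_trans decr _; rewrite -!addrA lerD2l.
have p1 : p != 0 by rewrite gt_eqF.
have m1 : m != 0 by rewrite gt_eqF.
(* With p = sqrt |g| and m = sqrt M, the step has length p / m, and each part
   of the model is compared with p ^+ 3 / m = |g|^(3/2) / sqrt M. *)
have lin : - (m * p)^-1 * (p ^+ 2) ^+ 2 = - (p ^+ 3 / m).
  by field; rewrite p1 m1.
have quadm : - (m * p)^-1 * (- (m * p)^-1 * q) <= p ^+ 3 / m.
  have -> : - (m * p)^-1 * (- (m * p)^-1 * q) = q / (m * p) ^+ 2.
    by field; rewrite p1 m1.
  rewrite ler_pdivrMr ?exprn_gt0 ?mulr_gt0 //.
  by apply: le_trans quad _; rewrite le_eqVlt; apply/orP; left; apply/eqP; field.
have cub : H * ((m * p)^-1 * p ^+ 2) ^+ 3 <= p ^+ 3 / m.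
  have -> : H * ((m * p)^-1 * p ^+ 2) ^+ 3 = H * p ^+ 3 / m ^+ 3.
    by field; rewrite p1 m1.
  rewrite ler_pdivrMr ?exprn_gt0 //.
  have -> : p ^+ 3 / m * m ^+ 3 = m ^+ 2 * p ^+ 3 by field.
  by rewrite ler_pM2r // exprn_gt0.
have -> : 1 / (6 * m) * p ^+ 3 = 1 / 6 * (p ^+ 3 / m) by field.
rewrite lin; lra.
Qed.

(** * The rate of the gap *)

(** For s > 0 the hypothesis factors as
    s k ^+ 3 <= L (s k - s k.+1) (s k + s k.+1) with s k.+1 <= s k, so that
    1 / s k.+1 - 1 / s k >= 1 / (2 L).  The conclusion is this telescoped
    bound on 1 / s k, in a form that also makes sense when s or L vanishes. *)
Lemma sqrt_gap_rate (R : realType) (L : R) (s : nat -> R) :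
  0 <= L -> (forall k, 0 <= s k) ->
  (forall k, s k ^+ 3 <= L * (s k ^+ 2 - s k.+1 ^+ 2)) ->
  forall k, k%:R * s k <= 2 * L.
Proof.
move=> L0 s0 decr.
move: L0; rewrite le0r => /orP[/eqP L0 k|L0].
  have : s k ^+ 3 <= 0 by rewrite (le_trans (decr k)) // L0 mul0r.
  rewrite le_eqVlt ltNge exprn_ge0 // orbF expf_eq0 /= => /eqP ->.
  by rewrite L0 !mulr0.
elim=> [|k IH]; first by rewrite mul0r mulr_ge0 // ltW.
have mono : s k.+1 <= s k.
  rewrite -(ler_pXn2r (n := 2)) ?nnegrE //.
  by rewrite -subr_ge0 -(pmulr_rge0 _ L0) (le_trans _ (decr k)) // exprn_ge0.
have [sk0|] := eqVneq (s k) 0.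
  have -> : s k.+1 = 0 by apply/eqP; rewrite eq_le s0 andbT -sk0.
  by rewrite mulr0 mulr_ge0 // ltW.
rewrite neq_lt ltNge s0 /= => sk0.
have drop : s k * s k.+1 <= 2 * L * (s k - s k.+1).
  have sq : s k ^+ 2 <= 2 * L * (s k - s k.+1).
    rewrite -(ler_pM2l sk0) -exprS.
    apply: le_trans (decr k) _.
    have -> : L * (s k ^+ 2 - s k.+1 ^+ 2)
      = (s k + s k.+1) * (L * (s k - s k.+1)) by ring.
    have -> : s k * (2 * L * (s k - s k.+1))
      = (s k + s k) * (L * (s k - s k.+1)) by ring.
    by rewrite ler_wpM2r ?lerD2l // mulr_ge0 ?subr_ge0 // ltW.
  by apply: le_trans sq; rewrite expr2 ler_pM2l.
rewrite -(ler_pM2l sk0).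
have := ler_wpM2r (s0 k.+1) IH.
rewrite -natr1; lra.
Qed.

(** * The convergence theorem *)

Theorem mainTheorem4 (R : realType) :
  exists c : R, 0 < c /\
  forall (d : nat) (f : 'rV[R]_d -> R) (H C M D : R)
         (x0 xstar : 'rV[R]_d) (x : nat -> 'rV[R]_d),
    convex_function setT f ->
    twice_differentiable f ->
    0 < H ->
    (forall x y : 'rV[R]_d,
       f y <= f x + dotv (grad f x) (y - x)
              + 1 / 2 * dotv ((y - x) *m hessian f x) (y - x)
              + H / 3 * enorm (y - x) ^+ 3) ->
    (forall x y : 'rV[R]_d,
       enorm (grad f y - grad f x - (y - x) *m hessian f x)
         <= H * enorm (y - x) ^+ 2) ->
    (forall y : 'rV[R]_d, f xstar <= f y) ->
    has_ubound [set enorm (y - xstar) | y in [set y | f y <= f x0]] ->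
    D = sup [set enorm (y - xstar) | y in [set y | f y <= f x0]] ->
    0 < C ->
    M = Num.max H C ->
    x 0%N = x0 ->
    (forall k : nat,
       x k.+1 = if grad f (x k) == 0 then x k
                else x k - (Num.sqrt (M * enorm (grad f (x k))))^-1
                             *: grad f (x k)) ->
    (forall k : nat, grad f (x k) != 0 ->
       dotv (grad f (x k)) (grad f (x k) *m hessian f (x k))
         / enorm (grad f (x k)) ^+ 2
         <= Num.sqrt (C * enorm (grad f (x k)))) ->
    (forall k : nat,
       f (x k.+1) <= f (x k)
         - 1 / (6 * Num.sqrt M) * enorm (grad f (x k)) `^ (3 / 2)) /\
    (forall k : nat, (1 <= k)%N ->
       f (x k) - f xstar
         <= c * ((Num.sqrt (M * D ^+ 3) + Num.sqrt (f x0 - f xstar)) ^+ 2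
                 / k%:R ^+ 2)).
Proof.
exists 144; split => // d f H C M D x0 xstar x cf [df _] H0 upper _ fmin.
move=> bounded DE C0 ME x_0 step curv.
have HM : H <= M by rewrite ME le_max lexx.
have CM : C <= M by rewrite ME le_max lexx orbT.
have m0 : 0 < Num.sqrt M by rewrite sqrtr_gt0 (lt_le_trans H0).
have decr k : f (x k.+1) <= f (x k)
    - 1 / (6 * Num.sqrt M) * enorm (grad f (x k)) `^ (3 / 2).
  rewrite step; have [g0|g0] := eqVneq (grad f (x k)) 0.
    have /eqP -> : enorm (grad f (x k)) == 0 by rewrite enorm_eq0 g0.
    by rewrite powR_3half // sqrtr0 expr0n mulr0 subr0.
  exact: (@regularized_step_decrease _ _ _ H C) (curv k g0).
split=> // k k1.
have level j : f (x j) <= f x0.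
  elim: j => [|j IH]; first by rewrite x_0.
  apply: le_trans IH; apply: le_trans (decr j) _.
  by rewrite gerBl mulr_ge0 ?powR_ge0 // divr_ge0 // mulr_ge0 ?ltW.
have dist j : enorm (x j - xstar) <= D.
  by rewrite DE; apply: ub_le_sup => //; exists (x j) => //=; exact: level.
have D0 : 0 <= D by apply: le_trans (dist 0%N); exact: enorm_ge0.
have gap0 j : 0 <= f (x j) - f xstar by rewrite subr_ge0.
have gapD j : f (x j) - f xstar <= enorm (grad f (x j)) * D.
  have := convex_gradient_le _ _ _ _ xstar cf (df (x j)).
  rewrite -opprB -scaleN1r dotvZr mulN1r => tangent.
  apply: (@le_trans _ _ (dotv (grad f (x j)) (x j - xstar))); first lra.
  apply: le_trans (dotv_le_enorm _ _) _.
  by rewrite ler_wpM2l ?enorm_ge0.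
pose s j := Num.sqrt (f (x j) - f xstar).
have sE j : s j ^+ 2 = f (x j) - f xstar by rewrite sqr_sqrtr.
have L0 : 0 <= Num.sqrt (M * D ^+ 3) by exact: sqrtr_ge0.
have LE : Num.sqrt (M * D ^+ 3) = Num.sqrt M * Num.sqrt D ^+ 3.
  rewrite sqrtrM; last by rewrite (le_trans _ HM) // ltW.
  by congr (_ * _); rewrite -{1}(sqr_sqrtr D0) exprAC sqrtr_sqr ger0_norm //.
have srec j : s j ^+ 3 <= 6 * Num.sqrt (M * D ^+ 3) * (s j ^+ 2 - s j.+1 ^+ 2).
  rewrite !sE LE.
  set p := Num.sqrt (enorm (grad f (x j))); set r := Num.sqrt D.
  have r0 : 0 <= r by exact: sqrtr_ge0.
  have sj : s j <= p * r.
    by rewrite -sqrtrM ?enorm_ge0 // ler_wsqrtr.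
  have s3 : s j ^+ 3 <= (p * r) ^+ 3.
    by apply: lerXn2r => //; rewrite nnegrE ?mulr_ge0 ?sqrtr_ge0.
  have drop : p ^+ 3 <= 6 * Num.sqrt M * (f (x j) - f (x j.+1)).
    have := decr j; rewrite powR_3half ?enorm_ge0 // -/p => dj.
    rewrite mulrC -ler_pdivrMr ?mulr_gt0 //.
    by move: dj; rewrite mul1r [_ * p ^+ 3]mulrC; lra.
  apply: le_trans s3 _; rewrite exprMn.
  apply: le_trans (ler_wpM2r (exprn_ge0 3 r0) drop) _.
  by rewrite le_eqVlt; apply/orP; left; apply/eqP; ring.
have s_ge0 j : 0 <= s j by exact: sqrtr_ge0.
have rate := sqrt_gap_rate _ _ _ (mulr_ge0 (ler0n _ 6) L0) s_ge0 srec k.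
have k0 : 0 < k%:R :> R by rewrite ltr0n.
rewrite mulrA ler_pdivlMr ?exprn_gt0 // -sE -exprMn.
have -> : 144 = 12 ^+ 2 :> R by rewrite -natrX.
rewrite -exprMn; apply: lerXn2r.
- by rewrite nnegrE mulr_ge0 // ltW.
- by rewrite nnegrE mulr_ge0 // addr_ge0 // sqrtr_ge0.
rewrite mulrC (le_trans rate) // mulrA -natrM ler_wpM2l //.
by rewrite lerDl sqrtr_ge0.
Qed.
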